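(* Let $n,n_1\ge 1$, let $f_k:\mathbb{R}^n\to\mathbb{R}^n$ and $h_k:\mathbb{R}^n\to\mathbb{R}^{n_1}$ be functions differentiable at $\hat{x}_k\in\mathbb{R}^n$, with Jacobian matrices $J_{f_k}$, $J_{h_k}$ at $\hat{x}_k$. Let $P_k\in\mathbb{R}^{n\times n}$, $Q_k\in\mathbb{R}^{n\times n}$, $R_k\in\mathbb{R}^{n_1\times n_1}$ be symmetric positive definite, and let $E_k$ be the Cholesky factor of $P_k$, $P_k=E_kE_k^T$. Let $\mathcal{E}_{f_k}$ and $\mathcal{E}_{h_k}$ be ellipsoids with centers $e_{f_k}\in\mathbb{R}^n$, $e_{h_k}\in\mathbb{R}^{n_1}$ and shape matrices $P_{f_k}=B_{f_k}B_{f_k}^T$, $P_{h_k}=B_{h_k}B_{h_k}^T$ (symmetric positive definite, with $B_{f_k}\in\mathbb{R}^{n\times n}$, $B_{h_k}\in\mathbb{R}^{n_1\times n_1}$), such that for all $u\in\mathbb{R}^n$ with $\|u\|\le 1$, $$\Delta f_k(u):=f_k(\hat{x}_k+E_ku)-f_k(\hat{x}_k)-J_{f_k}E_ku\in\mathcal{E}_{f_k},\qquad \Delta h_k(u):=h_k(\hat{x}_k+E_ku)-h_k(\hat{x}_k)-J_{h_k}E_ku\in\mathcal{E}_{h_k}.$$ Let $y_k\in\mathbb{R}^{n_1}$ be given. For $\hat{x}_{k+1|k}\in\mathbb{R}^n$ define the block matrices $$\Phi_{k+1|k}(\hat{x}_{k+1|k})=[\,f_k(\hat{x}_k)+e_{f_k}-\hat{x}_{k+1|k},\;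 J_{f_k}E_k,\; I,\; 0,\; B_{f_k},\; 0\,],$$ $$\Psi_{k+1|k}(y_k)=[\,h_k(\hat{x}_k)+e_{h_k}-y_k,\; J_{h_k}E_k,\; 0,\; I,\; 0,\; B_{h_k}\,],$$ whose column blocks have widths $1,n,n,n_1,n,n_1$, and let $(\Psi_{k+1|k}(y_k))_\perp$ be an orthogonal complement of $\Psi_{k+1|k}(y_k)$. For real $\tau^u,\tau^w,\tau^v,\tau^f,\tau^h$ let $$\Xi=\operatorname{diag}(1-\tau^u-\tau^w-\tau^v-\tau^f-\tau^h,\;\tau^uI,\;\tau^wQ_k^{-1},\;\tau^vR_k^{-1},\;\tau^fI,\;\tau^hI).$$ Let $f$ be a real-valued size function of the shape matrix (e.g. $f(P)=\operatorname{tr}(P)$ or $f(P)=\log\det(P)$). Suppose $P_{k+1|k}$ (symmetric $n\times n$), $\hat{x}_{k+1|k}$, $\tau^u,\tau^w,\tau^v,\tau^f,\tau^h$ solve the optimization problem $$\min\ f(P_{k+1|k})\quad\text{subject to}\quad \tau^u,\tau^w,\tau^v,\tau^f,\tau^h\ge 0,\quad -P_{k+1|k}\prec 0,$$ $$\begin{bmatrix}-P_{k+1|k} & \Phi_{k+1|k}(\hat{x}_{k+1|k})(\Psi_{k+1|k}(y_k))_\perp\\ (\Phi_{k+1|k}(\hat{x}_{k+1|k})(\Psi_{k+1|k}(y_k))_\perp)^T & -(\Psi_{k+1|k}(y_k))_\perp^T\,\Xi\,(\Psi_{k+1|k}(y_k))_\perp\end{bmatrix}\preceq 0 .$$ Then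 $\mathcal{E}_{k+1|k}=\{x\in\mathbb{R}^n:(x-\hat{x}_{k+1|k})^TP_{k+1|k}^{-1}(x-\hat{x}_{k+1|k})\le 1\}$ is a predicted bounding ellipsoid for the state: for all $x_k,w_k\in\mathbb{R}^n$ and $v_k\in\mathbb{R}^{n_1}$ with $(x_k-\hat{x}_k)^TP_k^{-1}(x_k-\hat{x}_k)\le 1$, $w_k^TQ_k^{-1}w_k\le 1$, $v_k^TR_k^{-1}v_k\le 1$ and $y_k=h_k(x_k)+v_k$, the next state $x_{k+1}=f_k(x_k)+w_k$ belongs to $\mathcal{E}_{k+1|k}$.
   Context: The setting is a nonlinear dynamic system $x_{k+1}=f_k(x_k)+w_k$, $y_k=h_k(x_k)+v_k$ with state $x_k\in\mathbb{R}^n$, measurement $y_k\in\mathbb{R}^{n_1}$, unknown but bounded process noise $w_k$ and measurement noise $v_k$. The ellipsoid with center $e\in\mathbb{R}^m$ and symmetric positive definite shape matrix $P=BB^T$ is $\{x\in\mathbb{R}^m:(x-e)^TP^{-1}(x-e)\le 1\}=\{e+B\Delta:\Delta\in\mathbb{R}^m,\ \|\Delta\|\le 1\}$, with $\|\cdot\|$ the Euclidean norm. An orthogonal complement $\Psi_\perp$ of a matrix $\Psi$ is a matrix whose columns form a basis of the null space $\{\xi:\Psi\xi=0\}$. $A\prec 0$ (resp. $A\preceq 0$) means that the symmetric matrix $A$ is negative definite (resp. negative semidefinite). $\operatorname{diag}$ denotes a block-diagonal matrix; $I$ and $0$ are identity and zero blocks of compatible dimensions. *)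

(* Defs.v *)
From HB Require Import structures.
From mathcomp Require Import all_boot all_order all_algebra.
From mathcomp Require Import all_classical all_reals all_analysis.

Set Implicit Arguments.
Unset Strict Implicit.
Unset Printing Implicit Defensive.

Import Order.TTheory GRing.Theory Num.Theory.
Import numFieldNormedType.Exports.

Local Open Scope classical_set_scope.
Local Open Scope ring_scope.

(* Vectors are column vectors. *)

Section Matrices.
Context {R : realType}.

(* The library norm `|x| on matrices is the sup norm, hence this definition. *)
Definition enorm m (x : 'cV[R]_m) : R := Num.sqrt (\sum_i x i 0 ^+ 2).

Definition qform m (A : 'M[R]_m) (x : 'cV[R]_m) : R := (x^T *m A *m x) 0 0.

Definition posdefmx m (A : 'M[R]_m) : Prop :=
  A^T = A /\ forall x : 'cV[R]_m, x != 0 -> 0 < qform A x.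

Definition negdefmx m (A : 'M[R]_m) : Prop :=
  A^T = A /\ forall x : 'cV[R]_m, x != 0 -> qform A x < 0.

Definition negsemidefmx m (A : 'M[R]_m) : Prop :=
  A^T = A /\ forall x : 'cV[R]_m, qform A x <= 0.

(* [is_trig_mx] is lower triangularity: E i j = 0 for i < j. *)
Definition cholesky_factor m (P E : 'M[R]_m) : Prop :=
  [/\ is_trig_mx E, forall i, 0 < E i i & P = E *m E^T].

Definition ellipsoid m (e : 'cV[R]_m) (P : 'M[R]_m) : set 'cV[R]_m :=
  [set x | qform (invmx P) (x - e) <= 1].

(* The columns of N are linearly independent and span the null space of Psi. *)
Definition orthogonal_complement p q r
    (Psi : 'M[R]_(p, q)) (N : 'M[R]_(q, r)) : Prop :=
  row_free N^T /\
  forall xi : 'cV[R]_q, Psi *m xi = 0 <-> exists eta : 'cV[R]_r, xi = N *m eta.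

(* The library's [jacobian] acts on row vectors from the right; transposing
   gives the usual matrix of partial derivatives, see [JacE]. *)
Definition Jac n m (g : 'cV[R]_n -> 'cV[R]_m) (x : 'cV[R]_n) : 'M[R]_(m, n) :=
  (jacobian (fun z : 'rV[R]_n => (g z^T)^T) x^T)^T.

Lemma continuous_trmx m n :
  continuous (trmx : 'M[R]_(m, n) -> 'M[R]_(n, m)).
Proof.
move=> u A /nbhs_ballP[e /= e0 eA]; apply/nbhs_ballP; exists e => //= v [_ uv].
by apply: eA; split => // i j; rewrite !mxE; exact: uv.
Qed.

Lemma JacE n m (g : 'cV[R]_n -> 'cV[R]_m) x v :
  differentiable g x -> 'd g x v = Jac g x *m v.
Proof.
move=> dg; rewrite /Jac /jacobian.
have dtr p q (y : 'M[R]_(p,q)) : differentiable trmx y.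
  exact/linear_differentiable/continuous_trmx.
have Dtr p q (y : 'M[R]_(p,q)) : 'd trmx y = trmx :> (_ -> _).
  exact/diff_lin/continuous_trmx.
rewrite -[RHS]trmxK trmx_mul trmxK.
have -> : (fun z : 'rV[R]_n => (g z^T)^T) = trmx \o (g \o trmx) by [].
have dgt : differentiable (g \o trmx) x^T by apply: differentiable_comp => //; rewrite trmxK.
have dg' : differentiable g x^T^T by rewrite trmxK.
rewrite mul_rV_lin1 (diff_comp dgt)//= (diff_comp _ dg')//=.
by rewrite !Dtr/= !trmxK.
Qed.

Definition linearization_error n m (g : 'cV[R]_n -> 'cV[R]_m)
    (xhat : 'cV[R]_n) (E : 'M[R]_n) (u : 'cV[R]_n) : 'cV[R]_m :=
  g (xhat + E *m u) - g xhat - Jac g xhat *m E *m u.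

Definition bdiag m p (A : 'M[R]_m) (B : 'M[R]_p) : 'M[R]_(m + p) :=
  block_mx A 0 0 B.

End Matrices.

(* Column blocks, in order: 1, u, w, v, and the two linearization errors. *)
Definition width (n n1 : nat) : nat := (1 + (n + (n + (n1 + (n + n1)))))%N.

Section Prediction.
Context {R : realType} {n n1 : nat}.

Definition Phi (f : 'cV[R]_n -> 'cV[R]_n) (xhat : 'cV[R]_n) (E : 'M[R]_n)
    (ef : 'cV[R]_n) (Bf : 'M[R]_n) (xpred : 'cV[R]_n) :
    'M[R]_(n, width n n1) :=
  row_mx (f xhat + ef - xpred)
    (row_mx (Jac f xhat *m E)
      (row_mx 1%:M (row_mx 0 (row_mx Bf 0)))).

Definition Psi (h : 'cV[R]_n -> 'cV[R]_n1) (xhat : 'cV[R]_n) (E : 'M[R]_n)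
    (eh : 'cV[R]_n1) (Bh : 'M[R]_n1) (y : 'cV[R]_n1) :
    'M[R]_(n1, width n n1) :=
  row_mx (h xhat + eh - y)
    (row_mx (Jac h xhat *m E)
      (row_mx 0 (row_mx 1%:M (row_mx 0 Bh)))).

Definition Xi (Q : 'M[R]_n) (Rv : 'M[R]_n1) (tu tw tv tf th : R) :
    'M[R]_(width n n1) :=
  bdiag (1 - tu - tw - tv - tf - th)%:M
    (bdiag tu%:M
      (bdiag (tw *: invmx Q)
        (bdiag (tv *: invmx Rv)
          (bdiag tf%:M th%:M)))).

Definition feasible r (PhiF : 'cV[R]_n -> 'M[R]_(n, width n n1))
    (N : 'M[R]_(width n n1, r)) (Q : 'M[R]_n) (Rv : 'M[R]_n1)
    (P : 'M[R]_n) (xpred : 'cV[R]_n) (tu tw tv tf th : R) : Prop :=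
  [/\ [/\ 0 <= tu, 0 <= tw, 0 <= tv, 0 <= tf & 0 <= th],
      negdefmx (- P) &
      negsemidefmx
        (block_mx (- P) (PhiF xpred *m N)
                  (PhiF xpred *m N)^T (- (N^T *m Xi Q Rv tu tw tv tf th *m N)))].

Definition optimal r (sizef : 'M[R]_n -> R)
    (PhiF : 'cV[R]_n -> 'M[R]_(n, width n n1))
    (N : 'M[R]_(width n n1, r)) (Q : 'M[R]_n) (Rv : 'M[R]_n1)
    (P : 'M[R]_n) (xpred : 'cV[R]_n) (tu tw tv tf th : R) : Prop :=
  feasible PhiF N Q Rv P xpred tu tw tv tf th /\
  forall (P' : 'M[R]_n) (xpred' : 'cV[R]_n) (tu' tw' tv' tf' th' : R),
    feasible PhiF N Q Rv P' xpred' tu' tw' tv' tf' th' -> sizef P <= sizef P'.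

End Prediction.

(* Main.v *)
(** The states compatible with the measurement are parametrized by the vectors
    xi = (1, u, w, v, a, b) of the kernel of Psi, where x = xhat + E u and a, b
    are the coordinates of the linearization errors in their ellipsoids; then
    Phi xi = f x + w - xpred.  Writing xi = N eta and completing the square in
    the linear matrix inequality bounds the quadratic form of P^-1 at Phi xi
    by that of Xi at xi (Schur complement), and the latter is at most 1 because
    the bounds on u, w, v, a, b enter it with nonnegative multipliers
    (S-procedure). *)

Require Import Defs.
From HB Require Import structures.
From mathcomp Require Import all_boot all_order all_algebra.
From mathcomp Require Import all_classical all_reals all_analysis.
From mathcomp Require Import ring lra.

Set Implicit Arguments.
Unset Strict Implicit.
Unset Printing Implicit Defensive.

Import Order.TTheory GRing.Theory Num.Theory.
Import numFieldNormedType.Exports.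

Local Open Scope classical_set_scope.
Local Open Scope ring_scope.

Section QuadraticForms.
Context {R : realType}.

Lemma qformZ m (a : R) (A : 'M[R]_m) x : qform (a *: A) x = a * qform A x.
Proof. by rewrite /qform -scalemxAr -scalemxAl mxE. Qed.

Lemma qformN m (A : 'M[R]_m) x : qform (- A) x = - qform A x.
Proof. by rewrite -scaleN1r qformZ mulN1r. Qed.

Lemma qform_scalar m (a : R) (x : 'cV[R]_m) : qform a%:M x = a * qform 1%:M x.
Proof. by rewrite -[a%:M]scalemx1 qformZ. Qed.

Lemma qform1 m (x : 'cV[R]_m) : qform 1%:M x = \sum_i x i 0 ^+ 2.
Proof.
by rewrite /qform mulmx1 mxE; apply: eq_bigr => i _; rewrite mxE expr2.
Qed.

Lemma qform_mulmx m p (A : 'M[R]_m) (C : 'M[R]_(m, p)) x :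
  qform A (C *m x) = qform (C^T *m A *m C) x.
Proof. by rewrite /qform trmx_mul !mulmxA. Qed.

Lemma qform_block m p (A : 'M[R]_m) (B : 'M[R]_(m, p)) (D : 'M[R]_p) x y :
  qform (block_mx A B B^T D) (col_mx x y) =
  qform A x + 2 * (x^T *m (B *m y)) 0 0 + qform D y.
Proof.
rewrite /qform tr_col_mx mul_row_block mul_row_col !mulmxDl -!mulmxA.
have -> : y^T *m (B^T *m x) = (x^T *m (B *m y))^T.
  by rewrite !trmx_mul trmxK mulmxA.
rewrite mxE [X in X + _]mxE [X in _ + X]mxE [(_^T) 0 0]mxE; ring.
Qed.

Lemma qform_bdiag m p (A : 'M[R]_m) (B : 'M[R]_p) x y :
  qform (bdiag A B) (col_mx x y) = qform A x + qform B y.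
Proof.
by have := qform_block A 0 B x y; rewrite trmx0 mul0mx mulmx0 mxE mulr0 addr0.
Qed.

(** A nonzero row [v] with [v *m A = 0] would make the form of [A] vanish at [v^T], against
    definiteness. *)
Lemma posdefmx_unit m (A : 'M[R]_m) : posdefmx A -> A \in unitmx.
Proof.
move=> [_ posA]; rewrite -row_free_unit; apply: inj_row_free => v vA0.
apply: contraTeq isT => v0; have := posA v^T.
rewrite /qform trmxK vA0 mul0mx mxE ltxx; apply.
by apply: contra v0 => /eqP vT0; rewrite -[v]trmxK vT0 trmx0.
Qed.

(** Since [B] is square and [P] invertible, [B] is invertible too, and [P^-1 = B^-T B^-1]; the code
    checks this identity after multiplying by [P] on the left. *)
Lemma qform_invmx_factor m (P B : 'M[R]_m) z : posdefmx P -> P = B *m B^T ->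
  qform (invmx P) z = qform 1%:M (invmx B *m z).
Proof.
move=> /posdefmx_unit Pu defP.
have Bu : B \in unitmx by move: Pu; rewrite defP unitmx_mul => /andP[].
have BTu : B^T \in unitmx by rewrite unitmx_tr.
rewrite qform_mulmx mulmx1 trmx_inv; congr (qform _ z).
apply: (can_inj (mulKmx Pu)); rewrite mulmxV// defP -mulmxA mulKVmx//.
by rewrite mulmxV.
Qed.

Lemma enorm_le1 m (x : 'cV[R]_m) : qform 1%:M x <= 1 -> enorm x <= 1.
Proof. by rewrite qform1 -{2}sqrtr1 => /ler_wsqrtr. Qed.

(** Passes from the inequality describing an ellipsoid to its image-of-the-unit-ball form; the
    coordinate vector is [B^-1 (x - e)]. *)
Lemma ellipsoid_factor m (e : 'cV[R]_m) (P B : 'M[R]_m) x :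
  posdefmx P -> P = B *m B^T -> ellipsoid e P x ->
  exists2 u, qform 1%:M u <= 1 & x = e + B *m u.
Proof.
move=> posP defP; rewrite /ellipsoid /= (qform_invmx_factor _ posP defP) => xE.
have Bu : B \in unitmx.
  by move: (posdefmx_unit posP); rewrite defP unitmx_mul => /andP[].
by exists (invmx B *m (x - e)) => //; rewrite mulKVmx// addrC subrK.
Qed.

(* Evaluate the block form at (P^-1 M eta, eta), the maximizer in its first
   argument. *)
Lemma schur_bound m p (P : 'M[R]_m) (M : 'M[R]_(m, p)) (S : 'M[R]_p) eta :
  posdefmx P -> negsemidefmx (block_mx (- P) M M^T (- S)) ->
  qform (invmx P) (M *m eta) <= qform S eta.
Proof.
move=> posP [_ lmi]; have Pu := posdefmx_unit posP.
have [symP _] := posP; set z := M *m eta.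
have := lmi (col_mx (invmx P *m z) eta).
rewrite qform_block !qformN -/z.
have -> : ((invmx P *m z)^T *m z) 0 0 = qform (invmx P) z.
  by rewrite /qform trmx_mul trmx_inv symP.
have -> : qform P (invmx P *m z) = qform (invmx P) z.
  by rewrite qform_mulmx trmx_inv symP mulVmx// mul1mx.
(* With q the form of [P^-1] at [z], the inequality now reads -q + 2q - [qform S eta] <= 0. *)
lra.
Qed.

(** The leading entry 1 contributes 1 minus the sum of the multipliers, and each other block
    contributes at most its own multiplier, so the multipliers cancel. *)
Lemma S_procedure n n1 (Q : 'M[R]_n) (Rv : 'M[R]_n1) (tu tw tv tf th : R)
    (u w a : 'cV[R]_n) (v b : 'cV[R]_n1) :
  [/\ 0 <= tu, 0 <= tw, 0 <= tv, 0 <= tf & 0 <= th] ->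
  qform 1%:M u <= 1 -> qform (invmx Q) w <= 1 -> qform (invmx Rv) v <= 1 ->
  qform 1%:M a <= 1 -> qform 1%:M b <= 1 ->
  qform (Xi Q Rv tu tw tv tf th)
    (col_mx (1%:M : 'M[R]_1)
      (col_mx u (col_mx w (col_mx v (col_mx a b))))) <= 1.
Proof.
move=> [tu0 tw0 tv0 tf0 th0] u1 w1 v1 a1 b1.
rewrite /Xi !qform_bdiag !qformZ.
rewrite [qform (1 - _ - _ - _ - _ - _)%:M _]qform_scalar (qform_scalar tu).
rewrite (qform_scalar tf) (qform_scalar th).
rewrite (_ : qform 1%:M (1%:M : 'M[R]_1) = 1); last first.
  by rewrite qform1 big_ord1 mxE expr1n.
have := ler_wpM2l tu0 u1; have := ler_wpM2l tw0 w1; have := ler_wpM2l tv0 v1.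
have := ler_wpM2l tf0 a1; have := ler_wpM2l th0 b1.
lra.
Qed.

End QuadraticForms.

Theorem theorem3p1 (R : realType) (n n1 : nat)
  (hn : (1 <= n)%N) (hn1 : (1 <= n1)%N)
  (f : 'cV[R]_n -> 'cV[R]_n) (h : 'cV[R]_n -> 'cV[R]_n1) (xhat : 'cV[R]_n)
  (df : differentiable f xhat) (dh : differentiable h xhat)
  (P Q : 'M[R]_n) (Rv : 'M[R]_n1)
  (posP : posdefmx P) (posQ : posdefmx Q) (posRv : posdefmx Rv)
  (E : 'M[R]_n) (cholE : cholesky_factor P E)
  (ef : 'cV[R]_n) (eh : 'cV[R]_n1)
  (Pf Bf : 'M[R]_n) (Ph Bh : 'M[R]_n1)
  (posPf : posdefmx Pf) (posPh : posdefmx Ph)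
  (defPf : Pf = Bf *m Bf^T) (defPh : Ph = Bh *m Bh^T)
  (errf : forall u : 'cV[R]_n, enorm u <= 1 ->
    ellipsoid ef Pf (linearization_error f xhat E u))
  (errh : forall u : 'cV[R]_n, enorm u <= 1 ->
    ellipsoid eh Ph (linearization_error h xhat E u))
  (y : 'cV[R]_n1)
  (r : nat) (N : 'M[R]_(width n n1, r))
  (orthN : orthogonal_complement (Psi h xhat E eh Bh y) N)
  (sizef : 'M[R]_n -> R)
  (Ppred : 'M[R]_n) (xpred : 'cV[R]_n) (tu tw tv tf th : R)
  (opt : optimal sizef (Phi f xhat E ef Bf) N Q Rv Ppred xpred tu tw tv tf th) :
  forall (x w : 'cV[R]_n) (v : 'cV[R]_n1),
    ellipsoid xhat P x ->
    ellipsoid 0 Q w ->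
    ellipsoid 0 Rv v ->
    y = h x + v ->
    ellipsoid xpred Ppred (f x + w).
Proof.
move=> x w v xP wQ vR defy.
have [[taus negP lmi] _] := opt.
have posPpred : posdefmx Ppred.
  case: negP => symP negP; split; first by apply: oppr_inj; rewrite -linearN.
  by move=> z /negP; rewrite qformN oppr_lt0.
have [_ _ defP] := cholE.
have [u u1 defx] := ellipsoid_factor posP defP xP.
have [a a1 defa] := ellipsoid_factor posPf defPf (errf u (enorm_le1 u1)).
have [b b1 defb] := ellipsoid_factor posPh defPh (errh u (enorm_le1 u1)).
move: wQ vR; rewrite /ellipsoid /= !subr0 => wQ vR.
pose xi : 'cV[R]_(width n n1) := col_mx (1%:M : 'M[R]_1)
  (col_mx u (col_mx w (col_mx v (col_mx a b)))).
move: defa defb; rewrite /linearization_error -defx => defa defb.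
(* This is the measurement equation: [eh + Bh *m b] is the exact linearization error at [u], so the
   product collapses to [h x + v - y]. *)
have Psi_xi : Psi h xhat E eh Bh y *m xi = 0.
  rewrite /Psi /xi !mul_row_col !mul0mx mulmx1 mul1mx.
  have -> : Bh *m b = h x - h xhat - Jac h xhat *m E *m u - eh.
    by rewrite defb addrC addKr.
  by apply/matrixP => i j; rewrite defy !mxE; ring.
have Phi_xi : Phi f xhat E ef Bf xpred *m xi = f x + w - xpred.
  rewrite /Phi /xi !mul_row_col !mul0mx mulmx1 mul1mx.
  have -> : Bf *m a = f x - f xhat - Jac f xhat *m E *m u - ef.
    by rewrite defa addrC addKr.
  by apply/matrixP => i j; rewrite !mxE; ring.
have [eta xiE] := (orthN.2 xi).1 Psi_xi.
have := schur_bound eta posPpred lmi.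
(* The form of [N^T Xi N] at [eta] is that of [Xi] at [N *m eta], which is [xi]; on the other side
   [Phi] times [xi] is the prediction error. *)
rewrite -qform_mulmx -mulmxA -xiE Phi_xi => /le_trans; apply.
exact: S_procedure.
Qed.
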